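(* Let $q=p^m$ be a power of a prime $p$, let $n,r,s$ be positive integers such that $s\mid n$ and $d:=(n,r)=(s,r)$, and let $c\in\mathbb{F}_{q^s}$ satisfy $N_{q^s|q^d}(c)=1$. Then the binomial $L_{c,r}(x):=x^{q^r}-cx\in\mathbb{F}_{q^n}[x]$ induces a permutation of $\ker(T_{q^n|q^s})$ if and only if $p\nmid n/s$. In this case a polynomial inducing the inverse map of $L_{c,r}$ restricted to $\ker(T_{q^n|q^s})$ is \[\sum_{j=0}^{\frac{s}{d}-1}c^{-\frac{q^{(j+1)r}-1}{q^r-1}}\left(\left(\frac{n}{s}\right)^{-1}\sum_{k=1}^{\frac{n}{s}-1}k\,x^{q^{\frac{ksr}{d}}}\right)^{q^{jr}}.\]
   Context: For a prime power $Q$ and positive integers $b\mid a$, $T_{Q^a|Q^b}(x)=\sum_{i=0}^{a/b-1}x^{Q^{ib}}$ is the trace map $\mathbb{F}_{Q^a}\to\mathbb{F}_{Q^b}$ and $N_{Q^a|Q^b}(x)=x^{(Q^a-1)/(Q^b-1)}$ the norm map. $\ker(T_{q^n|q^s})\subseteq\mathbb{F}_{q^n}$ is the kernel of the trace. Integers such as $n/s$ and $k$ are viewed as elements of the prime field $\mathbb{F}_p$, and $(n/s)^{-1}$ is the inverse there. *)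

(* Defs.v *)
From HB Require Import structures.
From mathcomp Require Import all_boot all_order all_algebra all_field.

Set Implicit Arguments.
Unset Strict Implicit.
Unset Printing Implicit Defensive.

Import GRing.Theory.
Local Open Scope ring_scope.

Section Maps.
Variable L : fieldType.

(* T_{Q^a|Q^b} and N_{Q^a|Q^b}, meant for b dividing a and applied to elements
   of the subfield of order Q^a; values are kept in L. *)
Definition trace_map (Q a b : nat) (x : L) : L :=
  \sum_(i < (a %/ b)%N) x ^+ (Q ^ (i * b))%N.

Definition norm_map (Q a b : nat) (x : L) : L :=
  x ^+ ((Q ^ a - 1) %/ (Q ^ b - 1))%N.

Definition trace_ker (Q a b : nat) : {pred L} :=
  [pred x | trace_map Q a b x == 0].

Definition Lbinom (q : nat) (c : L) (r : nat) : {poly L} :=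
  'X^(q ^ r) - c *: 'X.

(* All the nat divisions below are exact when d = gcdn s r and s divides n.
   The integers k and n / s are taken in the prime field of L through %:R. *)
Definition inv_poly (q : nat) (c : L) (n r s d : nat) : {poly L} :=
  \sum_(j < (s %/ d)%N)
    c ^- ((q ^ (j.+1 * r) - 1) %/ (q ^ r - 1))%N *:
      (((n %/ s)%N%:R)^-1 *:
         \sum_(1 <= k < (n %/ s)%N) k%:R *: 'X^(q ^ ((k * s * r) %/ d)))
      ^+ (q ^ (j * r))%N.

Definition induces_permutation (A : {pred L}) (P : {poly L}) : Prop :=
  [/\ {in A, forall x, P.[x] \in A},
      {in A &, injective (horner P)}
    & {in A, forall y, exists2 x, x \in A & P.[x] = y}].

(* G maps A to A and, on A, is a two-sided inverse of P. *)
Definition induces_inverse (A : {pred L}) (P G : {poly L}) : Prop :=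
  [/\ {in A, forall y, G.[y] \in A},
      {in A, cancel (horner P) (horner G)}
    & {in A, cancel (horner G) (horner P)}].

End Maps.

(* Main.v *)
(* Write [sigma] for [x |-> x^(q^r)] and [N = n / s]. As [c] has norm 1, Hilbert
   90 gives a nonzero [z] in [K] with [sigma z = c z], so that
   [L_{c,r} (z x) = sigma z * (sigma x - x)], and the proposed inverse becomes
   [y |-> z * \sum_(j < s / d) sigma^j (h y / sigma z)], where [h] is the weighted
   trace [N^-1 \sum_k k tau^k] and [tau = sigma^(s / d)] fixes [K]. The sum over
   [j] telescopes to [tau w - w], and [tau (h y) - h y = y - N^-1 Tr y], because
   [tau] generates the group of [L / K]. When [p] divides [N], the element [z]
   itself has trace [N z = 0] and is killed by [L_{c,r}]. *)
Require Import Defs.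
From HB Require Import structures.
From mathcomp Require Import all_boot all_order all_algebra all_field.
From mathcomp Require Import cyclic ring.

Import GRing.Theory.
Local Open Scope ring_scope.

Section Frobenius.
Variables (F : finFieldType) (L : fieldExtType F).
Implicit Types (K : {subfield L}) (x y c : L).

(** * Powers of the Frobenius map of [L] over [F], indexed so that composition adds exponents *)

Definition frob (e : nat) (x : L) : L := x ^+ (#|F| ^ e).

Lemma pnat_card_pchar : [pchar L].-nat #|F|.
Proof.
have [p p_prime pF] := finPcharP F.
have -> : #|F| = (p ^ logn p #|F|)%N := card_pprimeChar pF.
by rewrite pnatX pnatE // pchar_lalg pF.
Qed.

Lemma frob_is_nmod_morphism e : nmod_morphism (frob e).
Proof.
split=> [|x y]; first by rewrite /frob expr0n expn_eq0 -leqn0 leqNgt (cardD1 0).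
by rewrite /frob exprDn_pchar // pnatX pnat_card_pchar.
Qed.

Lemma frob_is_monoid_morphism e : monoid_morphism (frob e).
Proof. by split=> [|x y]; rewrite /frob (expr1n, exprMn). Qed.

HB.instance Definition _ e :=
  GRing.isNmodMorphism.Build L L (frob e) (frob_is_nmod_morphism e).
HB.instance Definition _ e :=
  GRing.isMonoidMorphism.Build L L (frob e) (frob_is_monoid_morphism e).

Lemma frob0 x : frob 0 x = x.
Proof. by rewrite /frob expr1. Qed.

Lemma frobD a b x : frob (a + b) x = frob a (frob b x).
Proof. by rewrite /frob -exprM -expnD addnC. Qed.

Lemma frobC a b x : frob a (frob b x) = frob b (frob a x).
Proof. by rewrite -!frobD addnC. Qed.

Lemma frob_fixM a k x : frob a x = x -> frob (k * a) x = x.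
Proof.
by move=> fix_x; elim: k => [|k IH]; rewrite ?mulSn ?frobD ?IH // frob0.
Qed.

Lemma frob_fix_mod a b t x :
  frob t x = x -> a = b %[mod t] -> frob a x = frob b x.
Proof.
move=> fix_x eq_ab; rewrite (divn_eq a t) (divn_eq b t) eq_ab.
by rewrite ![(_ * t + _)%N]addnC !frobD !frob_fixM.
Qed.

Lemma mem_frob K x : (x \in K) = (frob (\dim K) x == x).
Proof. exact: Fermat's_little_theorem. Qed.

Lemma frob_dim x : frob (\dim {:L}) x = x.
Proof. by apply/eqP; rewrite -(mem_frob (aspacef L)) memvf. Qed.

(** * Cyclicity of the multiplicative group of [K], and Hilbert 90 *)

Lemma subfield_has_prim_root K :
  exists2 g : L, g \in K & (#|F| ^ \dim K - 1).-primitive_root g.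
Proof.
have q_gt1 := finNzRing_gt1 F.
have N_gt0 : (0 < #|F| ^ \dim K - 1)%N.
  by rewrite subn_gt0 -(exp1n (\dim K)) ltn_exp2r // adim_gt0.
pose A := [pred x : finvect_type L | (x \in K) && (x != 0)].
have nz_unity (x : L) : x \in K -> x != 0 -> x ^+ (#|F| ^ \dim K - 1) = 1.
  move=> Kx nz_x; apply: (mulIf nz_x); rewrite mul1r -exprSr subn1 prednK.
    by apply/eqP; rewrite -mem_frob.
  by rewrite expn_gt0 ltnW.
(* As many distinct roots of unity as their common exponent must include a primitive one; the
   nonzero elements of [K] are such a family. *)
have /hasP[g] : has (#|F| ^ \dim K - 1).-primitive_root (enum A : seq L).
  apply: has_prim_root; rewrite ?N_gt0 //; last 2 first.
  - exact: (enum_uniq A).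
  - rewrite -[size _](cardE A).
    have <- : #|[pred x : finvect_type L | x \in K]| = (#|F| ^ \dim K)%N.
      exact: card_vspace (K : {vspace finvect_type L}).
    rewrite [X in (X - 1)%N](cardD1 (0 : finvect_type L)) [_ \in _]mem0v addKn.
    by apply/subset_leq_card/subsetP=> x; rewrite !inE andbC.
  apply/allP=> x; rewrite [_ \in _](mem_enum A) => /andP[Kx nz_x].
  exact/unity_rootP/nz_unity.
by rewrite [_ \in _](mem_enum A) => /andP[Kg _]; exists g.
Qed.

(* As [K^*] is cyclic, [c = y^(q^d - 1)] for some [y] in [K], and Bezout writes
   [d] as [k r] modulo [s]; then [z] is the product of the [sigma^j y], [j < k]. *)
Lemma Hilbert90_frob K r c d :
  (0 < r)%N -> d = gcdn (\dim K) r -> c \in K -> norm_map #|F| (\dim K) d c = 1 ->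
  exists z, [/\ z \in K, z != 0 & frob r z = c * z].
Proof.
move=> r_gt0 dE Kc norm_c; set s := \dim K in dE norm_c.
have q_gt1 := finNzRing_gt1 F; have q_gt0 := ltnW q_gt1.
have d_gt0 : (0 < d)%N by rewrite dE gcdn_gt0 r_gt0 orbT.
have d_dvd_s : (d %| s)%N by rewrite dE dvdn_gcdl.
have qs_gt1 : (1 < #|F| ^ s)%N by rewrite -(exp1n s) ltn_exp2r // adim_gt0.
have qd_gt1 : (1 < #|F| ^ d)%N by rewrite -(exp1n d) ltn_exp2r.
have qd_dvd_qs : (#|F| ^ d - 1 %| #|F| ^ s - 1)%N.
  by rewrite !subn1 -(divnK d_dvd_s) mulnC expnM dvdn_pred_predX.
rewrite /norm_map in norm_c; set E := ((#|F| ^ s - 1) %/ (#|F| ^ d - 1))%N in norm_c.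
have E_gt0 : (0 < E)%N by rewrite divn_gt0 ?subn_gt0 // dvdn_leq // subn_gt0.
have nz_c : c != 0.
  by apply/eqP=> c0; move/eqP: norm_c; rewrite c0 expr0n gtn_eqF // eq_sym oner_eq0.
have [g Kg prim_g] := subfield_has_prim_root K.
have c_unity : c ^+ (#|F| ^ s - 1) = 1.
  by rewrite -(divnK qd_dvd_qs) exprM norm_c expr1n.
have [i ci] := prim_rootP prim_g c_unity.
(* The norm condition reads [g ^+ (i * E) = 1], and the order of [g] is [(#|F| ^ d - 1) * E]; cancel
   [E]. *)
have qd_dvd_i : (#|F| ^ d - 1 %| i)%N.
  rewrite -(dvdn_pmul2r E_gt0) [X in (X %| _)%N]mulnC divnK //.
  by rewrite (prim_order_dvd prim_g) exprM -ci -/E norm_c.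
pose y := g ^+ (i %/ (#|F| ^ d - 1)).
have Ky : y \in K by rewrite rpredX.
have cy : frob d y = c * y.
  rewrite ci -(divnK qd_dvd_i) exprM -/y -exprSr subn1 prednK //.
  by rewrite expn_gt0 q_gt0.
have nz_y : y != 0.
  by rewrite expf_neq0 // (prim_root_eq0 prim_g) -lt0n subn_gt0.
have [k l kr _] := egcdnP s r_gt0.
have krE : (k * r = l * s + d)%N by rewrite kr dE gcdnC.
exists (\prod_(j < k) frob (j * r) y); split.
- by apply: rpred_prod => j _; rewrite rpredX.
- by apply/prodf_neq0 => j _; rewrite fmorph_eq0.
apply: (mulIf nz_y); rewrite mulrAC -cy.
have -> : frob d y = frob (k * r) y.
  by rewrite krE addnC frobD frob_fixM //; apply/eqP; rewrite -mem_frob.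
(* For every [k], both sides are the product of [frob (j * r) y] over [j <= k]. *)
elim: k {kr krE} => [|k IH]; first by rewrite !big_ord0 rmorph1 mul1r mulr1.
rewrite !big_ord_recr rmorphM /= mulrAC IH mulSn frobD; ring.
Qed.

(** * Telescoping sums and the weighted trace *)

Lemma telescope_frob M r x :
  \sum_(j < M) frob (j * r) (frob r x - x) = frob (M * r) x - x.
Proof.
rewrite -(big_mkord xpredT (fun j => frob (j * r) (frob r x - x))).
rewrite -[X in _ - X](frob0 x) -[0%N](mul0n r).
rewrite -(telescope_sumr (fun j => frob (j * r) x) (leq0n M)).
by apply: eq_bigr => j _; rewrite rmorphB /= mulSn addnC frobD.
Qed.

(** With [N = n / s] and [t = s * (r / d)], this is the value at [x] of the inner polynomial of
    [inv_poly]. *)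
Definition weighted_avg (N t : nat) (x : L) : L :=
  N%:R^-1 * \sum_(1 <= k < N) k%:R * frob (k * t) x.

Lemma weighted_avg_is_zmod_morphism N t : zmod_morphism (weighted_avg N t).
Proof.
move=> x y; rewrite /weighted_avg -mulrBr -sumrB; congr (_ * _).
by apply: eq_bigr => k _; rewrite rmorphB mulrBr.
Qed.

HB.instance Definition _ N t :=
  GRing.isZmodMorphism.Build L L (weighted_avg N t)
    (weighted_avg_is_zmod_morphism N t).

Lemma weighted_avg_frob N t e x :
  weighted_avg N t (frob e x) = frob e (weighted_avg N t x).
Proof.
rewrite /weighted_avg rmorphM fmorphV rmorph_nat rmorph_sum; congr (_ * _).
by apply: eq_bigr => k _; rewrite rmorphM rmorph_nat frobC.
Qed.

Lemma weighted_avgMl N t a x :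
  frob t a = a -> weighted_avg N t (a * x) = a * weighted_avg N t x.
Proof.
move=> fix_a; rewrite /weighted_avg [RHS]mulrCA (mulr_sumr _ _ _ a); congr (_ * _).
by apply: eq_bigr => k _; rewrite rmorphM /= frob_fixM // mulrCA.
Qed.

(** Summation by parts: up to a vanishing full sum, the weights [k] turn the difference into a
    telescoping sum, of value [N%:R * x]. *)
Lemma frob_weighted_avg N t x :
  N%:R != 0 :> L -> frob (N * t) x = x -> \sum_(k < N) frob (k * t) x = 0 ->
  frob t (weighted_avg N t x) - weighted_avg N t x = x.
Proof.
move=> nz_N fix_x sum0; rewrite -weighted_avg_frob -raddfB /=.
have N_gt0 : (0 < N)%N by case: N nz_N {fix_x sum0} => //; rewrite eqxx.
apply: (mulfI nz_N); rewrite mulVKf //.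
transitivity (\sum_(0 <= k < N) k%:R * frob (k * t) (frob t x - x)).
  by rewrite [RHS]big_ltn // mul0r add0r.
have sum1 : \sum_(0 <= k < N) frob (k.+1 * t) x = 0.
  rewrite big_mkord (eq_bigr (fun k : 'I_N => frob t (frob (k * t) x))).
    by rewrite -rmorph_sum sum0 rmorph0.
  by move=> k _; rewrite mulSn frobD.
(* Adding this zero raises the weight of [frob (k.+1 * t) x] from [k] to [k.+1], as telescoping
   requires. *)
rewrite -[LHS]addr0 -[X in _ + X]sum1 -big_split /=.
rewrite (eq_bigr (fun k => k.+1%:R * frob (k.+1 * t) x - k%:R * frob (k * t) x)).
  by rewrite telescope_sumr // fix_x mul0r subr0.
move=> k _; rewrite rmorphB /= -frobD [(k * t + t)%N]addnC -mulSn -natr1; ring.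
Qed.

(** * The trace, and its expression through another generator *)

Section Trace.
Variables n s : nat.
Local Notation Tr := (trace_map #|F| n s : L -> L).

Lemma trace_map_is_zmod_morphism : zmod_morphism Tr.
Proof.
move=> x y; rewrite /trace_map -sumrB.
by apply: eq_bigr => i _; exact: rmorphB (frob (i * s)) x y.
Qed.

HB.instance Definition _ :=
  GRing.isZmodMorphism.Build L L Tr trace_map_is_zmod_morphism.

Lemma trace_map_frob e x : Tr (frob e x) = frob e (Tr x).
Proof.
by rewrite /trace_map rmorph_sum; apply: eq_bigr => i _; exact: frobC.
Qed.

Lemma trace_mapMl a x : frob s a = a -> Tr (a * x) = a * Tr x.
Proof.
move=> fix_a; rewrite /trace_map mulr_sumr; apply: eq_bigr => i _.
by rewrite exprMn -/(frob (i * s) a) frob_fixM.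
Qed.

Lemma trace_map_fixed a : frob s a = a -> Tr a = a *+ (n %/ s).
Proof.
move=> fix_a; rewrite -[(n %/ s)%N]card_ord -sumr_const.
by apply: eq_bigr => i _; exact: frob_fixM.
Qed.

(* Multiplication by u permutes the residues modulo n / s. *)
Lemma trace_map_coprime u x :
  (0 < n %/ s)%N -> coprime (n %/ s) u -> frob (n %/ s * s) x = x ->
  Tr x = \sum_(k < (n %/ s)%N) frob (k * (s * u)) x.
Proof.
set N := (n %/ s)%N => N_gt0 co_Nu fix_x.
pose h (i : 'I_N) : 'I_N := Ordinal (ltn_pmod (i * u) N_gt0).
have h_inj : injective h.
  move=> i j /(congr1 val) /= /eqP eq_ij; apply: val_inj => /=.
  (* With [j <= i], the congruence says that [N] divides [(i - j) * u], and coprimality removes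
     [u]. *)
  wlog le_ij : i j eq_ij / (j <= i)%N.
    by move=> W; case/orP: (leq_total j i) => /W->; rewrite // eq_sym.
  move: eq_ij; rewrite eqn_mod_dvd ?leq_mul2r ?le_ij ?orbT //.
  by rewrite -mulnBl Gauss_dvdl // -eqn_mod_dvd // !modn_small // => /eqP.
rewrite [Tr x](reindex_inj h_inj); apply: eq_bigr => i _ /=.
rewrite -[LHS]/(frob (((i * u) %% N)%N * s) x); apply: frob_fix_mod fix_x _.
by rewrite -muln_modl modn_mod muln_modl mulnAC mulnA.
Qed.

End Trace.

(** * Values of the binomial and of the proposed inverse *)

Lemma horner_Lbinom c r x : (Lbinom #|F| c r).[x] = frob r x - c * x.
Proof. by rewrite /Lbinom !hornerE. Qed.

(** Since [c = z ^+ (#|F| ^ r - 1)], the denominator of the exponent cancels. *)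
Lemma expr_geom_frob r c z j : (0 < r)%N -> z != 0 -> frob r z = c * z ->
  c ^+ ((#|F| ^ (j * r) - 1) %/ (#|F| ^ r - 1))%N = frob (j * r) z / z.
Proof.
move=> r_gt0 nz_z cz; have q_gt0 : (0 < #|F|)%N := ltnW (finNzRing_gt1 F).
have expr_frob e : z ^+ (#|F| ^ e - 1) = frob e z / z.
  apply: (mulIf nz_z); rewrite divfK // -exprSr subn1 prednK //.
  by rewrite expn_gt0 q_gt0.
have -> : c = z ^+ (#|F| ^ r - 1) by rewrite expr_frob cz mulfK.
rewrite -exprM mulnC divnK ?expr_frob //.
by rewrite !subn1 mulnC expnM dvdn_pred_predX.
Qed.

(** The coefficient of index [j] is [z / frob (j.+1 * r) z]; its denominator is [frob (j * r)] of
    [frob r z], hence moves inside the Frobenius power. *)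
Lemma horner_inv_poly c n r s d z y :
  (0 < r)%N -> (d %| r)%N -> z != 0 -> frob r z = c * z ->
  (inv_poly #|F| c n r s d).[y] =
    z * \sum_(j < (s %/ d)%N)
          frob (j * r) (weighted_avg (n %/ s) (s * (r %/ d)) y / frob r z).
Proof.
move=> r_gt0 d_dvd_r nz_z cz; rewrite /inv_poly horner_sum mulr_sumr.
apply: eq_bigr => j _; rewrite hornerZ horner_exp hornerZ horner_sum.
rewrite (expr_geom_frob _ _ z) // invf_div rmorphM fmorphV /= -frobD [(j * r + r)%N]addnC.
rewrite -mulSn mulrAC -mulrA; congr (_ * (_ / _)); congr (_ ^+ _); congr (_ * _).
by apply: eq_bigr => k _; rewrite hornerZ hornerXn -muln_divA // -mulnA.
Qed.

End Frobenius.

Theorem theorem2p4 (p m n r s : nat)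
    (p_prime : prime p) (m_gt0 : (0 < m)%N)
    (n_gt0 : (0 < n)%N) (r_gt0 : (0 < r)%N) (s_gt0 : (0 < s)%N)
    (s_dvd_n : (s %| n)%N) (gcd_eq : gcdn n r = gcdn s r)
    (F : finFieldType) (card_F : #|F| = (p ^ m)%N)
    (L : fieldExtType F) (dim_L : \dim {:L} = n)
    (K : {subfield L}) (dim_K : \dim K = s)
    (c : L) (c_in_K : c \in K) :
  let q := (p ^ m)%N in
  let d := gcdn n r in
  norm_map q s d c = 1 ->
  (induces_permutation (@trace_ker L q n s) (Lbinom q c r)
     <-> ~~ (p %| n %/ s)%N)
  /\ (~~ (p %| n %/ s)%N ->
      induces_inverse (@trace_ker L q n s) (Lbinom q c r)
        (inv_poly q c n r s d)).
Proof.
move=> q d; rewrite {}/q -card_F => norm_c.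
set N := (n %/ s)%N; set A := @trace_ker _ _ _ _; set P := Lbinom _ _ _.
have nE : n = (N * s)%N by rewrite divnK.
have N_gt0 : (0 < N)%N by rewrite divn_gt0 // dvdn_leq.
have d_gt0 : (0 < d)%N by rewrite gcdn_gt0 n_gt0.
have d_dvd_r : (d %| r)%N := dvdn_gcdr n r.
have d_dvd_s : (d %| s)%N by rewrite /d gcd_eq dvdn_gcdl.
have [z [Kz nz_z cz]] : exists z, [/\ z \in K, z != 0 & frob F L r z = c * z].
  by apply: (Hilbert90_frob _ _ _ _ _ d); rewrite ?dim_K.
have fixK (x : L) : x \in K -> frob F L s x = x.
  by rewrite mem_frob dim_K => /eqP.
have frob_n (x : L) : frob F L (N * s) x = x by rewrite -nE -dim_L frob_dim.
pose u := (r %/ d)%N; pose t := (s * u)%N.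
(* This makes [frob t] a generator of the group of [L / K]: as [d] divides [s], [N] divides
   [n %/ d], which is coprime to [r %/ d]. *)
have co_Nu : coprime N u.
  have : coprime (n %/ d) u.
    by rewrite /coprime /u -(eqn_pmul2r d_gt0) muln_gcdl !divnK ?mul1n // dvdn_gcdl.
  apply: coprime_dvdl; rewrite nE -(divnK d_dvd_s) mulnA mulnK //.
  exact: dvdn_mulr.
(* Thus the telescoping sum over [j < s %/ d] ends exactly at [frob t]. *)
have Mr : (s %/ d * r = t)%N.
  by rewrite /t /u -{2}(divnK d_dvd_s) -mulnA [(d * _)%N]mulnC divnK.
have fix_t (x : L) : x \in K -> frob F L t x = x.
  by move=> Kx; rewrite /t mulnC frob_fixM // fixK.
have frob_Nt (x : L) : frob F L (N * t) x = x.
  by rewrite /t mulnA mulnC frob_fixM.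
have KerE (x : L) : (x \in A) = (trace_map #|F| n s x == 0) by [].
have KerMl (a x : L) : a \in K -> x \in A -> a * x \in A.
  by move=> Ka; rewrite !KerE trace_mapMl ?fixK // => /eqP->; rewrite mulr0.
have Ker_frob e (x : L) : x \in A -> frob F L e x \in A.
  by rewrite !KerE trace_map_frob => /eqP->; rewrite rmorph0.
have KerB (x y : L) : x \in A -> y \in A -> x - y \in A.
  by rewrite !KerE raddfB /= => /eqP-> /eqP->; rewrite subr0.
have Ker0 : 0 \in A by rewrite KerE raddf0.
have Ker_sum I (e : seq I) (f : I -> L) :
    (forall i, f i \in A) -> \sum_(i <- e) f i \in A.
  move=> Af; rewrite KerE raddf_sum big1 // => i _; exact/eqP/Af.
have PK : {in A, forall x, P.[x] \in A}.
  by move=> x Ax; rewrite horner_Lbinom KerB ?KerMl ?Ker_frob.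
have charL : p \in [pchar L] by rewrite pchar_lalg (card_finPcharP card_F).
have [p_dvd_N | p_ndvd_N] := boolP (p %| N)%N.
  split=> //; split=> // [[_ P_inj _]].
  have Az : z \in A.
    rewrite KerE trace_map_fixed ?fixK // -/N -(divnK p_dvd_N) mulrnA.
    by rewrite -mulr_natr (pcharf0 charL) mulr0.
  case/eqP: nz_z; apply: P_inj => //.
  by rewrite !horner_Lbinom cz subrr rmorph0 mulr0 subrr.
have nz_N : N%:R != 0 :> L by rewrite -(dvdn_pcharf charL).
set h := weighted_avg F L N t.
have Ah (x : L) : x \in A -> h x \in A.
  move=> Ax; apply: (KerMl); first by rewrite rpredV rpred_nat.
  by apply: (Ker_sum) => k; rewrite KerMl ?rpred_nat ?Ker_frob.
have h_diff (x : L) : x \in A -> frob F L t (h x) - h x = x.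
  move=> /eqP Ax; apply: frob_weighted_avg => //.
  by rewrite -(trace_map_coprime _ _ n).
have nz_fz : frob F L r z != 0 by rewrite fmorph_eq0.
have K_fz : frob F L r z \in K by rewrite rpredX.
pose G y := z * \sum_(j < (s %/ d)%N) frob F L (j * r) (h y / frob F L r z).
have GE y : (inv_poly #|F| c n r s d).[y] = G y by exact: horner_inv_poly.
have GK : {in A, forall y, G y \in A}.
  move=> y Ay; apply: (KerMl) => //; apply: (Ker_sum) => j.
  by apply: (Ker_frob); rewrite mulrC KerMl ?rpredV // Ah.
have P_mulz (x : L) : P.[z * x] = frob F L r z * (frob F L r x - x).
  by rewrite horner_Lbinom rmorphM /= mulrA -cz mulrBr.
have PG : {in A, forall y, P.[G y] = y}.
  move=> y Ay; rewrite P_mulz rmorph_sum -sumrB.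
  under eq_bigr => j _ do rewrite /= frobC -rmorphB.
  rewrite telescope_frob Mr rmorphM fmorphV /= (fix_t _ K_fz) -mulrBl h_diff //.
  by rewrite mulrC divfK.
have GP : {in A, forall x, G P.[x] = x}.
  move=> x Ax; have -> : x = z * (z^-1 * x) by rewrite mulVKf.
  (* For [x = z * y], the factor [frob r z] of [P.[x]] is fixed by [frob t], so it passes through
     [h] and cancels; what remains telescopes to [frob t (h y) - h y = y]. *)
  have : z^-1 * x \in A by rewrite KerMl ?rpredV.
  move: (z^-1 * x) => y Ay; rewrite P_mulz /G /h weighted_avgMl ?fix_t //.
  rewrite mulrAC divff // mul1r raddfB /= weighted_avg_frob.
  by rewrite telescope_frob Mr [_ - _]h_diff.
split; last by split=> x Ax; rewrite /= GE ?GK ?GP ?PG.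
split=> // _; split=> // [x y Ax Ay eqP | y Ay].
  by rewrite -(GP x Ax) -(GP y Ay) eqP.
by exists (G y); rewrite ?GK ?PG.
Qed.
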